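(* Let $T$ be a bounded linear operator on a separable complex Banach space $X$ with the $\mathscr P_{\overline{\mathcal{BD}}}$ property, and let $\lambda\in\mathbb C$ with $|\lambda|=1$. Then either $T=\lambda\,\mathrm{Id}$ or $T-\lambda\,\mathrm{Id}$ is not quasinilpotent.
   Context: $N_T(x,U)=\{n\in\mathbb N:T^nx\in U\}$. $\overline{\mathcal{BD}}$ is the family of sets $A\subseteq\mathbb N$ of positive upper Banach density, $\lim_n\sup_k\#(A\cap[k,k+n])/n>0$. $T$ has the $\mathscr P_{\overline{\mathcal{BD}}}$ property if for every nonempty open $U\subseteq X$ there is $x\in X$ with $N_T(x,U)\in\overline{\mathcal{BD}}$. An operator is quasinilpotent if its spectrum is $\{0\}$. *)

(* Defs.v *)
From HB Require Import structures.
From mathcomp Require Import all_boot all_order all_algebra.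
From mathcomp Require Import all_classical all_reals all_analysis.
From mathcomp.real_closed Require Import complex.
Set Implicit Arguments. Unset Strict Implicit. Unset Printing Implicit Defensive.
Import Order.TTheory GRing.Theory Num.Theory.
Import numFieldNormedType.Exports.
Local Open Scope classical_set_scope.
Local Open Scope ring_scope.

Definition return_set (X : Type) (T : X -> X) (x : X) (U : set X) : set nat :=
  [set n | U (iter n T x)].

Definition count_window (R : realType) (A : set nat) (k n : nat) : R :=
  \sum_(i <- iota k n.+1) (i \in A)%:R.

Definition window_sup (R : realType) (A : set nat) (n : nat) : R :=
  sup [set count_window R A k n / n%:R | k in [set: nat]].

Definition upper_banach_density (R : realType) (A : set nat) : R :=
  limn (window_sup R A).

Definition pos_upper_banach_density (R : realType) (A : set nat) : Prop :=
  0 < upper_banach_density R A.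

Definition P_BD (R : realType) (X : topologicalType) (T : X -> X) : Prop :=
  forall U : set X, open U -> U !=set0 ->
    exists x : X, pos_upper_banach_density R (return_set T x U).

Definition separable_space (X : topologicalType) : Prop :=
  exists D : set X, countable D /\ closure D = [set: X].

Definition op_invertible (K : numFieldType) (X : normedModType K) (S : X -> X) : Prop :=
  exists g : {linear X -> X}, continuous g /\ cancel S g /\ cancel g S.

Definition spectrum (K : numFieldType) (X : normedModType K) (S : X -> X) : set K :=
  [set mu | ~ op_invertible (fun x : X => S x - mu *: x)].

Definition quasinilpotent (K : numFieldType) (X : normedModType K) (S : X -> X) : Prop :=
  spectrum S = [set 0].

(* Main.v *)
Require Import Defs.
From HB Require Import structures.
From mathcomp Require Import all_boot all_order all_algebra.
From mathcomp Require Import all_classical all_reals all_analysis.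
From mathcomp.real_closed Require Import complex.
From mathcomp Require Import solvable.cyclic field.separable field.cyclotomic.
From mathcomp Require Import lra ring zify.
Import Order.TTheory GRing.Theory Num.Theory.
Import numFieldNormedType.Exports.
Local Open Scope classical_set_scope.
Local Open Scope ring_scope.
Local Open Scope complex_scope.

(** Write [T = lambda (I + Q)] with [Q] quasinilpotent, and suppose [Q x0 <> 0].
    Let [U] be a small ball around [x0].  Positive upper Banach density gives
    arbitrarily long windows [[k, k + N]] containing at least [c N] times [b]
    with [T^b x] in [U], [c] independent of [N]; by pigeonhole the phases
    [lambda^b] may be taken nearly equal and the times [b] of the same parity.
    If [b0] is the first such time and [y = T^b0 x], then along
    [0 < 1 < b1 - b0 < b1 - b0 + 1 < ...] the orbit of [y] under [I + Q] is
    alternately close to [x0] and to [x0 + Q x0].  Since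
    [(I + Q)^t y = \sum_k 'C(t, k) Q^k y] and the powers of [Q] decay faster
    than any geometric sequence, on the window this orbit is, up to a tiny error,
    a polynomial in [t] of degree smaller than the number of those times.  The
    divided difference of top order kills the polynomial, but its coefficients
    alternate in sign, so it cannot kill a sequence that alternates between two
    distinct vectors: hence [Q x0 = 0].

    The decay of the powers of [Q] is the spectral radius formula; the proof,
    free of complex analysis, rests on the identity
    [1/n \sum_(w^n = 1) (I - w z Q)^-1 = (I - z^n Q^n)^-1]. *)

(** Norms over [R[i]] are [R[i]]-valued; [rnorm] is the same norm with values in [R]. *)
Definition rnorm {R : realType} {V : normedZmodType R[i]} (x : V) : R :=
  complex.Re `|x|.

Lemma rnormE {R : realType} {V : normedZmodType R[i]} (x : V) :
  `|x| = (rnorm x)%:C.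
Proof. by rewrite RRe_real. Qed.

Lemma rnorm_ge0 {R : realType} {V : normedZmodType R[i]} (x : V) :
  0 <= rnorm x.
Proof. by rewrite -ler0c -rnormE. Qed.

Lemma rnormD {R : realType} {V : normedZmodType R[i]} (x y : V) :
  rnorm (x + y) <= rnorm x + rnorm y.
Proof. by rewrite -lecR rmorphD /= -!rnormE ler_normD. Qed.

Lemma rnormN {R : realType} {V : normedZmodType R[i]} (x : V) :
  rnorm (- x) = rnorm x.
Proof. by rewrite /rnorm normrN. Qed.

Lemma rnormC {R : realType} {V : normedZmodType R[i]} (x y : V) :
  rnorm (x - y) = rnorm (y - x).
Proof. by rewrite -rnormN opprB. Qed.

Lemma rnorm0 {R : realType} {V : normedZmodType R[i]} : rnorm (0 : V) = 0.
Proof. by rewrite /rnorm normr0. Qed.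

Lemma rnorm_eq0 {R : realType} {V : normedZmodType R[i]} (x : V) :
  rnorm x = 0 -> x = 0.
Proof. by move=> x0; apply/normr0_eq0; rewrite rnormE x0. Qed.

Lemma rnorm_sum {R : realType} {V : normedZmodType R[i]} (I : Type)
    (r : seq I) (P : pred I) (F : I -> V) :
  rnorm (\sum_(i <- r | P i) F i) <= \sum_(i <- r | P i) rnorm (F i).
Proof.
elim/big_ind2 : _ => [|x a y b xa yb|//]; first by rewrite rnorm0.
by rewrite (le_trans (rnormD _ _)) // lerD.
Qed.

Lemma rnormZ {R : realType} {V : normedModType R[i]} (a : R[i]) (x : V) :
  rnorm (a *: x) = rnorm a * rnorm x.
Proof.
by apply: (@complexI R); rewrite rmorphM /= -!rnormE normrZ.
Qed.

Lemma rnormM {R : realType} (a b : R[i]) : rnorm (a * b) = rnorm a * rnorm b.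
Proof. by apply: (@complexI R); rewrite rmorphM /= -!rnormE normrM. Qed.

Lemma rnormX {R : realType} (a : R[i]) n : rnorm (a ^+ n) = rnorm a ^+ n.
Proof.
elim: n => [|n IHn]; first by rewrite !expr0 /rnorm normr1.
by rewrite !exprS rnormM IHn.
Qed.

Lemma rnorm_real {R : realType} (a : R) : rnorm (a%:C : R[i]) = `|a|.
Proof. by rewrite /rnorm normc_def /= expr0n addr0 sqrtr_sqr. Qed.

Lemma rnorm_ReIm {R : realType} (z : R[i]) :
  rnorm z <= `|complex.Re z| + `|complex.Im z|.
Proof.
rewrite {1}[z]complexE (le_trans (rnormD _ _)) // rnormM !rnorm_real.
by rewrite /rnorm normc_def /= expr0n expr1n add0r sqrtr1 mul1r.
Qed.

Lemma Re_le_rnorm {R : realType} (z : R[i]) : `|complex.Re z| <= rnorm z.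
Proof. by rewrite -lecR -rnormE; exact: normc_ge_Re. Qed.

Lemma Im_le_rnorm {R : realType} (z : R[i]) : `|complex.Im z| <= rnorm z.
Proof.
rewrite -normrN -ReiNIm (le_trans (Re_le_rnorm _)) // rnormM.
by rewrite /rnorm [`|'i%C|]normc_def /= expr0n expr1n add0r sqrtr1 mulr1.
Qed.

Lemma linear_rnorm_bound {R : realType} {V W : normedModType R[i]}
    (f : {linear V -> W}) : continuous f ->
  exists2 M : R, 0 < M & forall x, rnorm (f x) <= M * rnorm x.
Proof.
move=> cf; have := @continuous_linear_bounded _ _ _ 0 f (cf 0).
move=> /linear_boundedP [y [yr fr]].
have yE : y = (complex.Re y)%:C by rewrite RRe_real.
set M := Num.max 0 (complex.Re y) + 1.
have M0 : 0 <= Num.max 0 (complex.Re y) by rewrite le_max lexx.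
exists M; first by rewrite /M; lra.
move=> x; have := fr (M%:C).
rewrite {1}yE ltcR.
have -> : complex.Re y < M by rewrite /M ltr_pwDr // le_max lexx orbT.
move=> /(_ isT x).
by rewrite !rnormE -rmorphM /= lecR.
Qed.

(** * Powers of a quasinilpotent operator *)

(** Over [R[i]] the polynomial ['X^n - 1] splits and is separable, and $n$ distinct $n$-th roots of
    unity in a field include a primitive one. *)
Lemma primitive_root_exists {R : rcfType} n : (0 < n)%N ->
  exists w : R[i], n.-primitive_root w.
Proof.
pose p : {poly R[i]} := 'X^n - 1; have [r Dp] := closed_field_poly_normal p.
move=> n_gt0; rewrite (monicP _) ?monicXnsubC // scale1r in Dp.
have rn1 : all n.-unity_root r by apply/allP=> z; rewrite -root_prod_XsubC -Dp.
have sz_r : (n < (size r).+1)%N.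
  by rewrite -(size_prod_XsubC r id) -Dp size_XnsubC.
have [|z] := hasP (has_prim_root n_gt0 rn1 _ sz_r); last by exists z.
by rewrite -separable_prod_XsubC -Dp separable_Xn_sub_1 // pnatr_eq0 -lt0n.
Qed.

Lemma sum_root_powers {F : fieldType} (n : nat) (w : F) (k : nat) :
  n.-primitive_root w -> (0 < k < n)%N -> \sum_(j < n) (w ^+ j) ^+ k = 0.
Proof.
move=> wn /andP[k0 kn].
have wk : w ^+ k - 1 != 0.
  by rewrite subr_eq0 -(prim_order_dvd wn) gtnNdvd.
apply: (mulfI wk); rewrite mulr0.
under eq_bigr do rewrite exprAC.
by rewrite -subrX1 exprAC (prim_expr_order wn) expr1n subrr.
Qed.

(** * Resolvents $(I-zQ)^{-1}$ and their averages over roots of unity *)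

Section Resolvent.
Context {R : realType} {X : normedModType R[i]}.
Variables (Q : {linear X -> X}) (Rz : R[i] -> {linear X -> X}).
Hypothesis RzK : forall z x, Rz z (x - z *: Q x) = x.
Hypothesis KRz : forall z x, Rz z x - z *: Q (Rz z x) = x.
Hypothesis Rz_bounded : forall z,
  exists2 M, 0 < M & forall x, rnorm (Rz z x) <= M * rnorm x.
Variable q : R.
Hypothesis q0 : 0 < q.
Hypothesis Qq : forall x, rnorm (Q x) <= q * rnorm x.

Lemma resolvent_identity z w x :
  Rz z x = Rz w x + (z - w) *: Rz z (Q (Rz w x)).
Proof.
rewrite -{1}(KRz w x).
have -> : Rz w x - w *: Q (Rz w x) =
   (Rz w x - z *: Q (Rz w x)) + (z - w) *: Q (Rz w x).
  by rewrite scalerBl addrA subrK.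
by rewrite linearD RzK linearZ.
Qed.

(** Near each point the bound on the resolvent at most doubles, and compactness makes it uniform.
    The square is convenient as a product of two compact segments. *)
Lemma resolvent_bounded_square (rho : R) : exists2 M, 1 <= M &
  forall z, `|complex.Re z| <= rho -> `|complex.Im z| <= rho ->
  forall x, rnorm (Rz z x) <= M * rnorm x.
Proof.
have /compact_near_coveringP := compact_setX
  (@segment_compact R (- rho) rho) (@segment_compact R (- rho) rho).
move=> /(_ R (pinfty_nbhs R)
  (fun M p => forall x, rnorm (Rz (p.1 +i* p.2) x) <= M * rnorm x) _).
case.
  move=> p _; have [M M0 HM] := Rz_bounded (p.1 +i* p.2).
  (* With this $d$ the perturbation term is at most $2dMq=1/2$ times $\|R_{z'}x\|$, so it is
     absorbed on the left. *)
  pose d := (4 * M * q)^-1.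
  have d0 : 0 < d by rewrite invr_gt0 !mulr_gt0.
  exists (ball p d, [set N | 2 * M <= N]) => /=.
    by split; [exact: nbhsx_ballx | apply: nbhs_pinfty_ge; exact: num_real].
  move=> [p' N] /= [[b1 b2] MN] x.
  have dz : rnorm ((p'.1 +i* p'.2) - (p.1 +i* p.2)) <= 2 * d.
    apply: (le_trans (rnorm_ReIm _)) => /=.
    move: b1 b2; rewrite /ball /= distrC [in X in _ -> X -> _]distrC.
    by lra.
  set z' := p'.1 +i* p'.2 in dz *; set z := p.1 +i* p.2 in dz HM.
  have e : rnorm (Rz z' x) <= M * rnorm x + 2^-1 * rnorm (Rz z' x).
    have E : Rz z' x = Rz z x + (z' - z) *: Rz z (Q (Rz z' x)).
      by rewrite (resolvent_identity z z' x) -(opprB z' z) scaleNr subrK.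
    rewrite {1}E (le_trans (rnormD _ _)) // lerD //.
    rewrite rnormZ.
    have := HM (Q (Rz z' x)); have := Qq (Rz z' x).
    set A := rnorm (Rz z' x); set B := rnorm _; set C := rnorm _ => h1 h2.
    have A0 : 0 <= A by exact: rnorm_ge0.
    apply: (@le_trans _ _ (2 * d * (M * (q * A)))).
      apply: ler_pM => //; rewrite ?rnorm_ge0 //.
      by apply: (le_trans h2); rewrite ler_pM2l.
    have -> : 2 * d * (M * (q * A)) = 2^-1 * A.
      by rewrite /d; field; rewrite !gt_eqF.
    by [].
  apply: (@le_trans _ _ (2 * M * rnorm x)); first by lra.
  by rewrite ler_wpM2r ?rnorm_ge0.
move=> M0 [_ H].
pose M := Num.max 1 M0 + 1.
exists M; first by rewrite /M (le_trans (_ : 1 <= Num.max 1 M0)) ?le_max ?lexx // lerDl.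
move=> z z1 z2 x.
have := H M _ (complex.Re z, complex.Im z); case: z z1 z2 => a b /= z1 z2.
apply; first by rewrite /M ltr_pwDr // le_max lexx orbT.
by split; rewrite /= in_itv /= -ler_norml.
Qed.

Lemma resolvent_telescope n w x :
  Rz w (x - w ^+ n *: iter n Q x) = \sum_(k < n) w ^+ k *: iter k Q x.
Proof.
rewrite -[RHS](RzK w); congr (Rz w _).
elim: n => [|n IHn]; first by rewrite big_ord0 expr0 scale1r linear0 scaler0 !subrr.
rewrite big_ord_recr /= linearD scalerDr opprD addrACA -IHn.
by rewrite [Q (_ *: _)]linearZ /= scalerA -exprS addrA subrK.
Qed.

(** By [resolvent_telescope] each summand is a truncated geometric series, and summing over the
    roots of unity kills the powers $0<k<n$. *)
Lemma resolvent_average n w z x : (0 < n)%N -> n.-primitive_root w ->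
  \sum_(j < n) Rz (w ^+ j * z) (x - z ^+ n *: iter n Q x) = n%:R *: x.
Proof.
move=> n0 wn.
have -> : \sum_(j < n) Rz (w ^+ j * z) (x - z ^+ n *: iter n Q x) =
    \sum_(j < n) \sum_(k < n) ((w ^+ j) ^+ k * z ^+ k) *: iter k Q x.
  apply: eq_bigr => j _.
  have -> : z ^+ n = (w ^+ j * z) ^+ n.
    by rewrite exprMn exprAC (prim_expr_order wn) expr1n mul1r.
  rewrite resolvent_telescope; apply: eq_bigr => k _; by rewrite exprMn.
rewrite exchange_big /=.
under eq_bigr do rewrite -scaler_suml -mulr_suml.
case: n n0 wn => // n _ wn; rewrite big_ord_recl [X in _ + X]big1 ?addr0 => [|k _].
  rewrite /= (eq_bigr (fun=> 1)) => [|j _]; last by rewrite expr0.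
  by rewrite sumr_const card_ord expr0 mulr1.
by rewrite (sum_root_powers _ _ _ wn) ?mul0r ?scale0r //= ltnS.
Qed.

Lemma resolvent_lipschitz M z w x :
  (forall y, rnorm (Rz z y) <= M * rnorm y) ->
  (forall y, rnorm (Rz w y) <= M * rnorm y) -> 0 <= M ->
  rnorm (Rz z x - Rz w x) <= rnorm (z - w) * (M * (q * (M * rnorm x))).
Proof.
move=> Hz Hw M0; rewrite (resolvent_identity z w x) addrC addKr rnormZ.
apply: ler_wpM2l; first exact: rnorm_ge0.
apply: (le_trans (Hz _)); apply: ler_wpM2l => //.
by apply: (le_trans (Qq _)); rewrite ler_pM2l.
Qed.

(* If [s^n Q^n] is small, so is the distance from [(I - s^n Q^n)^-1] to the
   identity; since averages of resolvents are Lipschitz uniformly in [n], the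
   same holds for [(I - r^n Q^n)^-1]. *)
Lemma power_bound_step (M eta r s : R) n : (0 < n)%N -> 1 <= M ->
  (forall z, rnorm z <= Num.max r s ->
     forall x, rnorm (Rz z x) <= M * rnorm x) ->
  0 <= r -> 0 <= s -> `|r - s| * (M * (q * M)) <= 4^-1 -> M * eta <= 4^-1 ->
  (forall x, s ^+ n * rnorm (iter n Q x) <= eta * rnorm x) ->
  forall x, r ^+ n * rnorm (iter n Q x) <= rnorm x.
Proof.
move=> n0 M1 HM r0 s0 rs Me Hs x.
have M0 : 0 <= M by apply: le_trans M1.
have [w wn] := @primitive_root_exists R n n0.
have nw j : rnorm (w ^+ j) = 1.
  rewrite rnormX; have : rnorm (w ^+ n) = 1.
    by rewrite (prim_expr_order wn) /rnorm normr1.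
  rewrite rnormX => /eqP; rewrite pexpr_eq1 ?rnorm_ge0 // => /eqP ->.
  by rewrite expr1n.
pose A t v := \sum_(j < n) Rz (w ^+ j * t%:C) v.
have nwt j t : 0 <= t -> rnorm (w ^+ j * t%:C) = t.
  by move=> t0; rewrite rnormM nw mul1r rnorm_real ger0_norm.
have Hr j y : rnorm (Rz (w ^+ j * r%:C) y) <= M * rnorm y.
  by apply: HM; rewrite nwt // le_max lexx.
have Hs' j y : rnorm (Rz (w ^+ j * s%:C) y) <= M * rnorm y.
  by apply: HM; rewrite nwt // le_max lexx orbT.
have sumC (c : R) : \sum_(j < n) c = n%:R * c.
  by rewrite sumr_const card_ord mulr_natl.
(* Since $A_s(v-s^nQ^nv)=nv$, the vector $A_sv$ is within $n\|v\|/4$ of $nv$; passing from $s$ to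
   $r$ costs another $n\|v\|/4$ by the Lipschitz bound. *)
have AB v : rnorm (A r v - n%:R *: v) <= n%:R * (2^-1 * rnorm v).
  have -> : A r v - n%:R *: v = (A r v - A s v) +
      \sum_(j < n) Rz (w ^+ j * s%:C) (s%:C ^+ n *: iter n Q v).
    have -> : n%:R *: v =
        A s v - \sum_(j < n) Rz (w ^+ j * s%:C) (s%:C ^+ n *: iter n Q v).
      rewrite -(resolvent_average _ _ s%:C v n0 wn) /A -sumrB.
      by apply: eq_bigr => j _; rewrite linearB.
    by rewrite opprB addrCA addrC.
  have -> : n%:R * (2^-1 * rnorm v) =
     \sum_(j < n) (4^-1 * rnorm v) + \sum_(j < n) (4^-1 * rnorm v).
    by rewrite !sumC; field.
  apply: (le_trans (rnormD _ _)); apply: lerD.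
    rewrite /A -sumrB (le_trans (rnorm_sum _ _ _ _)) //; apply: ler_sum => j _.
    apply: (le_trans (resolvent_lipschitz _ _ _ v (Hr j) (Hs' j) M0)).
    rewrite -mulrBr rnormM nw mul1r -rmorphB /= rnorm_real.
    have -> : `|r - s| * (M * (q * (M * rnorm v))) =
      `|r - s| * (M * (q * M)) * rnorm v by ring.
    by rewrite ler_wpM2r ?rnorm_ge0.
  rewrite (le_trans (rnorm_sum _ _ _ _)) //; apply: ler_sum => j _.
  apply: (le_trans (Hs' _ _)).
  rewrite rnormZ rnormX rnorm_real ger0_norm //.
  apply: (@le_trans _ _ (M * (eta * rnorm v))); first exact: ler_wpM2l.
  by rewrite mulrA ler_wpM2r ?rnorm_ge0.
set y := r%:C ^+ n *: iter n Q x.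
(* As $A_r(x-y)=nx$, this reads $\|y\|\le\frac12\|x-y\|$, which forces $\|y\|\le\|x\|$. *)
have := AB (x - y); rewrite /A (resolvent_average _ _ r%:C x n0 wn) -scalerBr.
rewrite opprB addrC subrK rnormZ -(rmorph_nat (real_complex R)) rnorm_real.
rewrite ger0_norm ?ler0n // ler_pM2l ?ltr0n //.
have -> : rnorm y = r ^+ n * rnorm (iter n Q x).
  by rewrite /y rnormZ rnormX rnorm_real ger0_norm.
move=> h; have := rnormD x (- y); rewrite rnormN.
have -> : rnorm y = r ^+ n * rnorm (iter n Q x).
  by rewrite /y rnormZ rnormX rnorm_real ger0_norm.
by lra.
Qed.

(** The radius climbs from $0$ to $\rho$ in steps of length $s$. Smallness [eta] at $ks$ gives the
    bound $1$ at $(k+2)s$ by [power_bound_step]; retreating to $(k+1)s$ gains the factor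
    $((k+1)/(k+2))^n\to0$, which restores [eta]. *)
Lemma power_decay (rho : R) : 0 < rho ->
  exists n0 : nat, forall n, (n0 <= n)%N -> forall x,
    rho ^+ n * rnorm (iter n Q x) <= rnorm x.
Proof.
move=> rho0.
(* The climb overshoots $\rho$ by one step $s\le\rho$, hence the radius $2\rho$. *)
have [M M1 HM'] := resolvent_bounded_square (2 * rho).
have HM z : rnorm z <= 2 * rho -> forall x, rnorm (Rz z x) <= M * rnorm x.
  move=> zr; apply: HM'; apply: le_trans zr; [exact: Re_le_rnorm | exact: Im_le_rnorm].
have M0 : 0 < M by apply: lt_le_trans M1.
pose eta := (4 * M)^-1.
have eta0 : 0 < eta by rewrite invr_gt0 mulr_gt0.
have eta1 : eta <= 1 by rewrite /eta invf_le1 ?mulr_gt0 //; lra.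
(* Makes $s=\rho/(K+1)$ so small that a jump of $2s$ satisfies $2sM^2q\le1/4$. *)
have [K HK] : exists K : nat, 8 * rho * (M * (q * M)) < K.+1%:R.
  exists (Num.truncn (8 * rho * (M * (q * M)))).
  by rewrite truncnS_gt.
pose s := rho / K.+1%:R.
have K0 : 0 < K.+1%:R :> R by rewrite ltr0n.
have s0 : 0 < s by rewrite divr_gt0.
have sK : K.+1%:R * s = rho by rewrite /s mulrC divfK ?gt_eqF.
suff claim k : (k <= K.+1)%N -> exists n0 : nat, forall n, (n0 <= n)%N ->
    forall x, (k%:R * s) ^+ n * rnorm (iter n Q x) <= eta * rnorm x.
  have [n0 Hn] := claim K.+1 (leqnn _); exists n0 => n nn x.
  by have := Hn n nn x; rewrite sK => /le_trans; apply; rewrite ler_piMl ?rnorm_ge0.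
elim: k => [_|k IHk kK].
  exists 1%N => n n1 x; rewrite mul0r expr0n -(negbK (n == 0%N)) -lt0n n1 /=.
  by rewrite mul0r mulr_ge0 ?rnorm_ge0 ?ltW.
have [n1 Hn1] := IHk (ltnW kK).
have kK' : k.+1%:R * s <= rho by rewrite -sK ler_pM2r // ler_nat.
have k2K' : k.+2%:R * s <= 2 * rho.
  have -> : k.+2%:R * s = k.+1%:R * s + s by rewrite -[k.+2%:R]natr1; ring.
  have : s <= k.+1%:R * s by rewrite ler_pMl // ler1n.
  lra.
pose r := k.+2%:R * s.
have r0 : 0 < r by rewrite mulr_gt0 ?ltr0n.
have rn n : (maxn 1 n1 <= n)%N -> forall x, r ^+ n * rnorm (iter n Q x) <= rnorm x.
  rewrite geq_max => /andP[n0 nn1].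
  apply: (power_bound_step M eta r (k%:R * s)) => //.
  - move=> z zm; apply: HM; apply: (le_trans zm); rewrite ge_max k2K' /=.
    apply: le_trans k2K'; rewrite ler_pM2r // ler_nat; lia.
  - exact: ltW.
  - by rewrite mulr_ge0 ?ler0n // ltW.
  - have -> : r - k%:R * s = 2 * s.
      by rewrite /r -[k.+2%:R]natr1 -[k.+1%:R]natr1; ring.
    rewrite ger0_norm ?mulr_ge0 ?ltW //.
    have -> : 2 * s * (M * (q * M)) =
        4^-1 * (8 * rho * (M * (q * M)) / K.+1%:R) by rewrite /s; field; rewrite gt_eqF.
    by rewrite gtr_pMr ?invr_gt0 // ltr_pdivrMr // mul1r.
  - by rewrite /eta invfM mulrCA mulfV ?gt_eqF // mulr1.
  - exact: Hn1.
pose c := k.+1%:R / k.+2%:R : R.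
have c0 : 0 <= c by rewrite divr_ge0.
have c1 : `|c| < 1 by rewrite ger0_norm // ltr_pdivrMr ?ltr0n // mul1r ltr_nat.
have := @cvg_expr R c c1; move/cvgr0Pnorm_lt => /(_ _ eta0) [n2 _ Hn2].
exists (maxn (maxn 1 n1) n2) => n; rewrite geq_max => /andP[na nb] x.
have -> : k.+1%:R * s = c * r by rewrite /c /r mulrA divfK ?gt_eqF ?ltr0n.
rewrite exprMn -mulrA; apply: ler_pM;
  rewrite ?exprn_ge0 ?mulr_ge0 ?exprn_ge0 ?rnorm_ge0 ?(ltW r0) //.
  by have := Hn2 n nb; rewrite /= ger0_norm ?exprn_ge0 // => /ltW.
exact: rn.
Qed.
End Resolvent.

Lemma quasinilpotent_power_decay {R : realType} {X : normedModType R[i]}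
    (Q : {linear X -> X}) : continuous Q -> quasinilpotent Q ->
  forall rho : R, 0 < rho -> exists n0 : nat, forall n, (n0 <= n)%N ->
    forall x, rho ^+ n * rnorm (iter n Q x) <= rnorm x.
Proof.
move=> Qc Qs.
have [q q0 Qq] := linear_rnorm_bound Q Qc.
have inv mu : mu != 0 -> op_invertible (fun x : X => Q x - mu *: x).
  move=> mu0; apply: contrapT => ninv.
  have : spectrum Q mu by [].
  by rewrite Qs => /= mu0'; rewrite mu0' eqxx in mu0.
have res z : exists G : {linear X -> X},
   [/\ forall x, G (x - z *: Q x) = x, forall x, G x - z *: Q (G x) = x &
     exists2 M : R, 0 < M & forall x, rnorm (G x) <= M * rnorm x].
  have [->|z0] := eqVneq z 0.
    exists (idfun : {linear X -> X}); split=> [x|x|] /=; rewrite ?scale0r ?subr0 //.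
    by exists 1 => // x; rewrite mul1r.
  have [g [gc [g1 g2]]] := inv z^-1 (invr_neq0 z0).
  (* $I-zQ=-z(Q-z^{-1})$, and $z^{-1}\ne0$ is outside the spectrum. *)
  exists ((- z^-1) \*: g : {linear X -> X}).
  have e1 x : x - z *: Q x = - z *: (Q x - z^-1 *: x).
    by rewrite scalerBr scalerA mulNr mulfV // scaleN1r opprK scaleNr addrC.
  split=> [x|x|].
  - by rewrite /= e1 linearZ /= g1 scalerA mulrNN mulVf // scale1r.
  - have e2 a y : Q (a *: y) - z^-1 *: (a *: y) = a *: (Q y - z^-1 *: y).
      by rewrite linearZ /= scalerBr !scalerA mulrC.
    by rewrite e1 /= e2 g2 scalerA mulrNN mulfV // scale1r.
  have [M M0 HM] := linear_rnorm_bound g gc.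
  have z1 : 0 < rnorm z^-1.
    rewrite lt_def rnorm_ge0 andbT; apply/eqP => /rnorm_eq0 /eqP.
    by rewrite invr_eq0 (negPf z0).
  exists (rnorm z^-1 * M); first exact: mulr_gt0.
  by move=> x; rewrite /= rnormZ rnormN -mulrA ler_wpM2l ?rnorm_ge0.
have [Rz HR] := choice res.
by apply: (power_decay Q Rz _ _ _ q q0 Qq) => z; have [] := HR z.
Qed.

(** * Divided differences *)

Definition divdiff_coef {F : fieldType} {n : nat} (t : 'I_n -> F) (i : 'I_n) : F :=
  (\prod_(j | j != i) (t i - t j))^-1.

(* The sum is the coefficient of degree n in the Lagrange interpolation of p. *)
Lemma divdiff_poly {F : fieldType} {n : nat} (t : 'I_n.+1 -> F)
    (p : {poly F}) : injective t -> (size p <= n)%N ->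
  \sum_i divdiff_coef t i * p.[t i] = 0.
Proof.
move=> tI sp.
pose l i := \prod_(j | j != i) ('X - (t j)%:P).
have lE i : l i = \prod_(x <- [seq t j | j <- enum [pred j | j != i]]) ('X - x%:P).
  by rewrite big_map big_enum.
have sE i : size [seq t j | j <- enum [pred j | j != i]] = n.
  by rewrite size_map -cardE; have := cardC1 i; rewrite card_ord /=.
have sl i : size (l i) = n.+1 by rewrite lE size_prod_XsubC sE.
have lc i : (l i)`_n = 1.
  have /monicP : l i \is monic by rewrite lE monic_prod_XsubC.
  by rewrite lead_coefE sl.
have hl i : (l i).[t i] = \prod_(j | j != i) (t i - t j).
  by rewrite horner_prod; apply: eq_bigr => j _; rewrite hornerXsubC.
have hl0 i k : k != i -> (l i).[t k] = 0.
  move=> ki; rewrite horner_prod (bigD1 k) //= hornerXsubC subrr mul0r //.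
have nz i : \prod_(j | j != i) (t i - t j) != 0.
  apply/prodf_neq0 => j ji; rewrite subr_eq0 (inj_eq tI) eq_sym //.
pose q := \sum_i (divdiff_coef t i * p.[t i]) *: l i.
(* The difference has degree at most $n$ and vanishes at the $n+1$ nodes. *)
have pq : p = q.
  apply/eqP; rewrite -subr_eq0; apply/eqP.
  apply: (@roots_geq_poly_eq0 _ _ [seq t j | j <- enum 'I_n.+1]).
  - apply/allP => _ /mapP[k _ ->]; rewrite /root hornerD hornerN horner_sum.
    rewrite (bigD1 k) //= big1 ?addr0 => [|i ik].
      rewrite hornerZ hl /divdiff_coef mulrAC mulVf // mul1r subrr //.
    by rewrite hornerZ hl0 1?eq_sym // mulr0.
  - by rewrite map_inj_uniq ?enum_uniq.
  - rewrite size_map size_enum_ord.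
    rewrite (leq_trans (size_polyD _ _)) // size_polyN geq_max leqW //=.
    apply: (leq_trans (size_sum _ _ _)); apply/bigmax_leqP => i _.
    by rewrite (leq_trans (size_scale_leq _ _)) // sl.
transitivity (q`_n); last by rewrite -pq nth_default.
rewrite coef_sum; apply: eq_bigr => i _; by rewrite coefZ lc mulr1.
Qed.

(** The negative factors of the product are the $n-i$ ones with $j>i$, and $n-i$ has the parity of
    $n+i$. *)
Lemma divdiff_sign {R : realFieldType} {n : nat} (t : 'I_n.+1 -> R) (i : 'I_n.+1) :
  {homo t : i j / (i < j)%N >-> i < j} ->
  divdiff_coef t i = (-1) ^+ (n + i) * `|divdiff_coef t i|.
Proof.
move=> tm.
have -> : (-1) ^+ (n + i) = \prod_(j < n.+1 | (i < j)%N) (-1 : R).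
  rewrite prodr_const.
  have -> : #|[pred j : 'I_n.+1 | (i < j)%N]| = (n - i)%N.
    rewrite -sum1_card /= (eq_bigl (fun j : 'I_n.+1 => (i.+1 <= j)%N)) //.
    rewrite -(big_geq_mkord i.+1 n.+1 xpredT (fun=> 1%N)) sum_nat_const_nat muln1.
    by rewrite subSS.
  have ni : (i <= n)%N by rewrite -ltnS.
  rewrite -{1}(subnK ni) -addnA addnn exprD -muln2 mulnC exprM.
  by rewrite sqrrN expr1n expr1n mulr1.
rewrite /divdiff_coef normfV normr_prod.
rewrite (bigID (fun j : 'I_n.+1 => (i < j)%N)) /=.
rewrite [X in _ * X^-1](bigID (fun j : 'I_n.+1 => (i < j)%N)) /=.
have -> : \prod_(j | (j != i) && (i < j)%N) (t i - t j) =
   \prod_(j < n.+1 | (i < j)%N) (-1) * \prod_(j | (j != i) && (i < j)%N) `|t i - t j|.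
  have e (j : 'I_n.+1) : (j != i) && (i < j)%N = (i < j)%N.
    by rewrite andbC; case: ltnP => //= ij; rewrite -val_eqE /= neq_ltn ij orbT.
  rewrite 2!(eq_bigl _ _ e) -big_split /=; apply: eq_bigr => j ij.
  by rewrite ltr0_norm ?subr_lt0 ?tm // mulN1r opprK.
have -> : \prod_(j | (j != i) && ~~ (i < j)%N) (t i - t j) =
   \prod_(j | (j != i) && ~~ (i < j)%N) `|t i - t j|.
  apply: eq_bigr => j /andP[ji ij].
  rewrite gtr0_norm // subr_gt0 tm // ltn_neqAle val_eqE ji /= leqNgt //.
rewrite -mulrA invfM; congr (_ * _).
by rewrite prodr_const -exprVn invrN invr1.
Qed.

Lemma ffact_poly {R : comNzRingType} (k : nat) :
  exists2 p : {poly R}, (size p <= k.+1)%N & forall m : nat, p.[m%:R] = (m ^_ k)%:R.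
Proof.
elim: k => [|k [p sp pE]].
  by exists 1; [rewrite size_poly1 | move=> m; rewrite hornerC ffactn0].
exists (p * ('X - k%:R%:P)).
  by rewrite (leq_trans (size_polyMleq _ _)) // size_XsubC addn2.
move=> m; rewrite hornerM hornerXsubC.
(* The subtraction $m-k$ is truncated in [nat]; for $m<k$ both sides vanish through [m ^_ k]. *)
rewrite pE ffactnSr natrM; have [km|mk] := leqP k m; first by rewrite natrB.
by rewrite ffact_small // !mul0r.
Qed.

(** Up to the factor $k!$, the binomial is a falling factorial, a polynomial of degree $k<n$ in the
    node. *)
Lemma divdiff_bin {R : numFieldType} {n : nat} (t : 'I_n.+1 -> nat) (k : nat) :
  injective t -> (k < n)%N ->
  \sum_i divdiff_coef (fun j => (t j)%:R : R) i * 'C(t i, k)%:R = 0.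
Proof.
move=> tI kn; have [p sp pE] := ffact_poly (R := R) k.
have kf : (k`!%:R : R) != 0 by rewrite pnatr_eq0 -lt0n fact_gt0.
apply: (mulIf kf); rewrite mul0r mulr_suml.
rewrite -[RHS](divdiff_poly (fun j => (t j)%:R : R) p _ (leq_trans sp kn)); last first.
  by move=> i j /eqP; rewrite eqr_nat => /eqP /tI.
by apply: eq_bigr => i _; rewrite -mulrA -natrM bin_ffact pE.
Qed.

(** Pascal's rule. The upper limit [m] is free above [n], so that one range of summation serves all
    the times of a window. *)
Lemma iter_add_binomial {R : realType} {X : normedModType R[i]}
    (Q : {linear X -> X}) (n m : nat) (y : X) : (n < m)%N ->
  iter n (fun x => x + Q x) y = \sum_(k < m) iter k Q y *+ 'C(n, k).
Proof.
elim: n => [|n IHn] nm.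
  case: m nm => // m _; rewrite big_ord_recl bin0 mulr1n big1 ?addr0 //.
rewrite iterS IHn ?(ltnW nm) // linear_sum /=.
case: m nm {IHn} => // m nm.
rewrite [RHS]big_ord_recl /= big_ord_recl /= !bin0 -addrA; congr (_ + _).
under [RHS]eq_bigr do rewrite /bump /= add1n binS mulrnDr.
rewrite big_split /=; congr (_ + _).
rewrite big_ord_recr /= bin_small // mulr0n linear0 addr0.
by apply: eq_bigr => k _; rewrite linearMn.
Qed.

(* The divided difference of the orbit only sees the terms [k >= n] of its
   binomial expansion, whereas that of the alternating sequence
   [x0, x0 + Q x0, x0, ...] is, up to sign, half the sum of the moduli of the
   coefficients times [Q x0]. *)
Lemma alternating_orbit_bound {R : realType} {X : normedModType R[i]}
    (Q : {linear X -> X}) (x0 y : X) (n T : nat) (t : 'I_n.+1 -> nat) (e e' : R) :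
  (0 < n)%N -> {homo t : i j / (i < j)%N >-> (i < j)%N} ->
  (forall i, (t i <= T)%N) ->
  (forall i, rnorm (iter (t i) (fun x => x + Q x) y -
               (if odd i then x0 + Q x0 else x0)) <= e) ->
  (forall k, (n <= k)%N -> 2 ^+ T * rnorm (iter k Q y) <= e') ->
  rnorm (Q x0) <= 2 * (e + e').
Proof.
move=> n0 tm tT He He'.
have tI : injective t.
  move=> i j tij; case: (ltngtP i j) => [ij|ji|/val_inj //].
    by have := tm _ _ ij; rewrite tij ltnn.
  by have := tm _ _ ji; rewrite tij ltnn.
pose c i : R := divdiff_coef (fun j => (t j)%:R : R) i.
have cE i : c i = (-1) ^+ (n + i) * `|c i|.
  by apply: divdiff_sign => a b ab; rewrite ltr_nat tm.
have csum : \sum_i c i = 0.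
  rewrite -[RHS](divdiff_bin (R := R) t 0 tI n0).
  by apply: eq_bigr => i _; rewrite bin0 mulr1.
pose W := \sum_i `|c i|.
have W0 : 0 < W.
  rewrite lt_def sumr_ge0 ?andbT //; apply/eqP => W0.
  have : `|c ord0| = 0 by apply: (psumr_eq0P (fun i _ => normr_ge0 (c i)) W0).
  move/normr0P; rewrite invr_eq0; apply/negP.
  apply/prodf_neq0 => j j0; rewrite subr_eq0 eqr_nat (inj_eq tI) eq_sym //.
pose S := fun x => x + Q x.
pose v (i : 'I_n.+1) := if odd i then x0 + Q x0 else x0.
have vsum : \sum_i (c i)%:C *: v i = (- (-1) ^+ n * W / 2)%:C *: Q x0.
  (* By [cE], $(c_i-(-1)^n|c_i|)/2$ equals $c_i$ for odd $i$ and $0$ for even $i$: it selects the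
     terms containing $Qx_0$. *)
  have -> : \sum_i (c i)%:C *: v i =
     \sum_i ((c i)%:C *: x0 + (2^-1 * (c i - (-1) ^+ n * `|c i|))%:C *: Q x0).
    apply: eq_bigr => i _; rewrite /v; have := cE i.
    rewrite exprD -(signr_odd _ i).
    case: (odd i) => /= h.
      rewrite scalerDr; congr (_ + (_ %:C) *: _).
      by move: h; rewrite expr1 mulrN1 mulNr; lra.
    move: h; rewrite expr0 mulr1 => <-.
    by rewrite subrr mulr0 scale0r addr0.
  rewrite big_split /= -!scaler_suml -!rmorph_sum /= csum scale0r add0r.
  congr ((_ %:C) *: _); rewrite -mulr_sumr sumrB csum -mulr_sumr -/W; ring.
(* The terms $k<n$ cancel by [divdiff_bin]; the others are at most [e' / 2 ^+ T] times binomials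
   that add up to $2^{t_i}\le2^T$. *)
have Zbound : rnorm (\sum_i (c i)%:C *: iter (t i) S y) <= W * e'.
  have -> : \sum_i (c i)%:C *: iter (t i) S y =
     \sum_i (c i)%:C *: \sum_(k < T.+1 | (n <= k)%N) iter k Q y *+ 'C(t i, k).
    under eq_bigr => i _ do
      rewrite (iter_add_binomial Q _ T.+1 y (tT i : (t i < T.+1)%N))
        (bigID (fun k : 'I_T.+1 => (n <= k)%N)) /= scalerDr.
    rewrite big_split /= [X in _ + X](_ : _ = 0) ?addr0 //.
    under eq_bigr do rewrite scaler_sumr.
    rewrite exchange_big big1 //= => k; rewrite -ltnNge => kn.
    under eq_bigr => i _ do
      rewrite -scaler_nat scalerA -(rmorph_nat (real_complex R)) -rmorphM /=.
    rewrite -scaler_suml -rmorph_sum /=.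
    by rewrite (divdiff_bin t k tI kn) scale0r.
  apply: (le_trans (rnorm_sum _ _ _ _)); rewrite /W mulr_suml.
  apply: ler_sum => i _; rewrite rnormZ rnorm_real ler_wpM2l //.
  apply: (le_trans (rnorm_sum _ _ _ _)).
  have e'0 : 0 <= e'.
    by apply: le_trans (He' n (leqnn _)); rewrite mulr_ge0 ?exprn_ge0 ?rnorm_ge0.
  apply: (@le_trans _ _ (\sum_(k < T.+1) ('C(t i, k))%:R * (e' / 2 ^+ T))).
    rewrite big_mkcond; apply: ler_sum => k _; case: ifP => nk; last first.
      by rewrite mulr_ge0 ?divr_ge0 ?exprn_ge0.
    rewrite -scaler_nat -(rmorph_nat (real_complex R)) rnormZ rnorm_real.
    rewrite ger0_norm // ler_wpM2l // ler_pdivlMr ?exprn_gt0 // mulrC.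
    exact: He'.
  rewrite -mulr_suml -natr_sum.
  have -> : (\sum_(k < T.+1) 'C(t i, k) = 2 ^ t i)%N.
    rewrite -[2%N]/(1 + 1)%N expnDn.
    rewrite -(big_mkord xpredT (fun k => 'C(t i, k))).
    rewrite (big_cat_nat (n := (t i).+1)) //=; last by rewrite ltnS.
    rewrite [X in (_ + X)%N]big_nat_cond [X in (_ + X)%N]big1 ?addn0; last first.
      by move=> k /andP[/andP[h _] _]; rewrite bin_small.
    by rewrite big_mkord; apply: eq_bigr => k _; rewrite !exp1n !muln1.
  rewrite natrX mulrCA; apply: ler_piMr => //.
  by rewrite ler_pdivrMr ?exprn_gt0 // mul1r ler_eXn2l // ltr1n.
have : rnorm ((- (-1) ^+ n * W / 2)%:C *: Q x0) <= W * e + W * e'.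
  rewrite -vsum.
  have -> : \sum_i (c i)%:C *: v i =
      \sum_i (c i)%:C *: (v i - iter (t i) S y) + \sum_i (c i)%:C *: iter (t i) S y.
    by rewrite -big_split; apply: eq_bigr => i _; rewrite /= -scalerDr subrK.
  apply: (le_trans (rnormD _ _)); apply: lerD => //.
  apply: (le_trans (rnorm_sum _ _ _ _)); rewrite /W mulr_suml.
  apply: ler_sum => i _; rewrite rnormZ rnorm_real ler_wpM2l // rnormC.
  exact: He.
rewrite rnormZ rnorm_real !normrM normrN normrX normrN1 expr1n mul1r.
rewrite (gtr0_norm W0) gtr0_norm ?invr_gt0 // -mulrDr -mulrA ler_pM2l //.
by rewrite ler_pdivrMl.
Qed.

(** * Positive upper Banach density *)

Lemma pigeonhole_count {C : finType} (c : nat -> C) (a0 : C) (s : seq nat) :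
  exists a, (size s <= #|C| * count (fun i => c i == a) s)%N.
Proof.
have C0 : (0 < #|C|)%N by apply/card_gt0P; exists a0.
have [a aE] := @bigop.eq_bigmax C (fun a => count (fun i => c i == a) s) C0.
exists a; rewrite -aE -sum_nat_const -sum1_size.
rewrite (partition_big c xpredT) //=; apply: leq_sum => b _.
by rewrite sum1_count; exact: leq_bigmax.
Qed.

Lemma count_windowE {R : realType} (A : set nat) k n :
  count_window R A k n = (count (fun i => i \in A) (iota k n.+1))%:R.
Proof.
rewrite /count_window -sum1_count natr_sum [RHS]big_mkcond /=.
by apply: eq_bigr => i _; case: (i \in A).
Qed.

Lemma has_ub_window {R : realType} (A : set nat) n :
  has_ubound [set count_window R A k n / n%:R | k in [set: nat]].
Proof.
exists (n.+1%:R / n%:R) => _ [k _ <-].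
rewrite ler_wpM2r ?invr_ge0 // count_windowE ler_nat.
by rewrite (leq_trans (count_size _ _)) ?size_iota.
Qed.

(** If no [D] worked, the counts in long windows would be $o(N)$ uniformly in the position, and the
    density would be $0$. *)
Lemma pos_density_windows {R : realType} (A : set nat) :
  pos_upper_banach_density R A ->
  exists D : nat, forall N0, exists N k : nat, (N0 <= N)%N /\
    (N <= D * count (fun i => i \in A) (iota k N.+1))%N.
Proof.
move=> Apos; apply: contrapT => noD.
have small D : exists N0, forall N k, (N0 <= N)%N ->
    (D * count (fun i => i \in A) (iota k N.+1) < N)%N.
  apply: contrapT => h; apply: noD; exists D => N0; apply: contrapT => h'.
  apply: h; exists N0 => N k NN; rewrite ltnNge; apply/negP => le.
  by apply: h'; exists N, k.
have : window_sup R A @ \oo --> (0 : R).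
  apply/cvgr0Pnorm_le => e e0.
  have [N0 HN] := small (Num.truncn e^-1).+1.
  exists (maxn 1 N0) => //= N /=; rewrite geq_max => /andP[N1 NN].
  have N0' : 0 < N%:R :> R by rewrite ltr0n.
  rewrite ger0_norm; last first.
    apply: (@le_trans _ _ (count_window R A 0 N / N%:R)).
      by rewrite divr_ge0 // count_windowE.
    by apply: ub_le_sup; [exact: has_ub_window | exists 0%N].
  apply: ge_sup; first by exists (count_window R A 0 N / N%:R), 0%N.
  move=> _ [k _ <-]; rewrite ler_pdivrMr // count_windowE.
  have := HN N k NN; rewrite -(ltr_nat R) natrM => /ltW h.
  rewrite mulrC -ler_pdivrMr //; apply: le_trans h.
  by rewrite mulrC ler_wpM2r // ltW // truncnS_gt.
move/cvg_lim => /(_ (@Rhausdorff R)) E.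
by move: Apos; rewrite /pos_upper_banach_density /upper_banach_density E ltxx.
Qed.

(** * Phases and parities of the return times *)

Lemma truncn_dist {R : realType} (x y : R) : 0 <= x -> 0 <= y ->
  Num.truncn x = Num.truncn y -> `|x - y| <= 1.
Proof.
move=> /truncn_itv /andP[x1 x2] /truncn_itv /andP[y1 y2] xy.
move: x1 x2 y1 y2; rewrite -natr1 -[(Num.truncn y).+1%:R]natr1 xy => *.
by rewrite ler_norml; apply/andP; split; lra.
Qed.

(** The colour records the parity of the exponent and the cell of side $1/M$ containing its power of
    [lam]; two points of a cell are at distance at most $2/M\le e$. *)
Lemma phase_coloring {R : realType} (lam : R[i]) (e : R) :
  `|lam| = 1 -> 0 < e ->
  exists (C : finType) (c : nat -> C), forall i j, c i = c j ->
    odd i = odd j /\ rnorm (lam ^+ i - lam ^+ j) <= e.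
Proof.
move=> lam1 e0.
pose M := (Num.truncn (2 / e)).+1.
have M0 : 0 < M%:R :> R by rewrite ltr0n.
have Me : 2 / M%:R <= e.
  by rewrite ler_pdivrMr // mulrC -ler_pdivrMr // ltW // truncnS_gt.
(* For $|x|\le1$ the integer part of $M(x+1)$ lies in $\{0,\dots,2M\}$, so [inord] does not fall
   back on its default. *)
pose cell (x : R) : 'I_(M * 2).+1 := inord (Num.truncn (M%:R * (x + 1))).
have cellP (x y : R) : `|x| <= 1 -> `|y| <= 1 -> cell x = cell y -> `|x - y| <= M%:R^-1.
  move=> x1 y1 xy.
  have nn (z : R) : `|z| <= 1 -> 0 <= M%:R * (z + 1).
    by rewrite ler_norml => /andP[h _]; rewrite mulr_ge0 //; lra.
  have lt (z : R) : `|z| <= 1 -> (Num.truncn (M%:R * (z + 1)) < (M * 2).+1)%N.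
    move=> z1; rewrite ltnS -(ler_nat R).
    have /andP[h _] := truncn_itv (nn z z1); apply: (le_trans h).
    by rewrite natrM ler_pM2l //; move: z1; rewrite ler_norml => /andP[_]; lra.
  have := congr1 val xy; rewrite /cell /= !inordK ?lt // => /truncn_dist.
  move=> /(_ (nn _ x1) (nn _ y1)).
  rewrite -mulrBr opprD addrACA subrr addr0 normrM gtr0_norm //.
  by rewrite mulrC -ler_pdivlMr // div1r.
exists (bool * ('I_(M * 2).+1 * 'I_(M * 2).+1))%type.
exists (fun i => (odd i, (cell (complex.Re (lam ^+ i)), cell (complex.Im (lam ^+ i))))).
have r1 i : rnorm (lam ^+ i) <= 1 by rewrite rnormX /rnorm lam1 /= expr1n.
move=> i j [-> cr ci]; split=> //.
apply: (le_trans (rnorm_ReIm _)); apply: le_trans Me.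
rewrite mulr_natl mulr2n; apply: lerD; rewrite raddfB /=; apply: cellP => //.
- exact: le_trans (Re_le_rnorm _) (r1 i).
- exact: le_trans (Re_le_rnorm _) (r1 j).
- exact: le_trans (Im_le_rnorm _) (r1 i).
- exact: le_trans (Im_le_rnorm _) (r1 j).
Qed.

(** Each $b$ in [bs] yields the two times $b-b_0$ and $b-b_0+1$. Equal parity keeps distinct
    elements at least $2$ apart, so the pairs do not overlap. *)
Lemma pair_times (bs : seq nat) (N k : nat) : (0 < size bs)%N ->
  sorted ltn bs -> {in bs &, forall i j, odd i = odd j} ->
  {in bs, forall i, (k <= i <= k + N)%N} ->
  let b0 := nth 0%N bs 0 in
  let t (i : nat) := (nth 0%N bs i./2 - b0 + odd i)%N in
  forall i, (i < (size bs).*2)%N ->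
    [/\ (t i <= N.+1)%N, (b0 <= nth 0%N bs i./2)%N &
      forall j, (i < j < (size bs).*2)%N -> (t i < t j)%N].
Proof.
move=> b0 sb pb kb.
have half i : (i < (size bs).*2)%N -> (i./2 < size bs)%N.
  by rewrite ltn_half_double.
have mon i j : (i < j < size bs)%N -> (nth 0%N bs i < nth 0%N bs j)%N.
  move=> /andP[ij js].
  by apply: (sorted_ltn_nth ltn_trans) => //; rewrite inE; lia.
have b0le i : (i < size bs)%N -> (nth 0%N bs 0 <= nth 0%N bs i)%N.
  by case: i => // i h; apply: ltnW; apply: mon.
move=> /= i ilt; have i2 := half i ilt.
have mi := mem_nth 0%N i2; have m0 := mem_nth 0%N b0.
have := kb _ mi; have := kb _ m0; have := b0le _ i2.
move=> hi /andP[h1 h2] /andP[h3 h4]; split=> //.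
  rewrite -addn1; apply: leq_add; last exact: leq_b1.
  by rewrite leq_subLR (leq_trans h4) // leq_add2r.
move=> j /andP[ij jlt]; have j2 := half j jlt; have mj := mem_nth 0%N j2.
have := b0le _ j2.
have [e|ne] := eqVneq (i./2) (j./2).
  rewrite e; have := odd_double_half i; have := odd_double_half j.
  by rewrite e; case: (odd i); case: (odd j) => /=; lia.
have := mon i./2 j./2; have -> : (i./2 < j./2 < size bs)%N by lia.
move=> /(_ isT) lt bj.
have := pb _ _ mi mj.
have := odd_double_half (nth 0%N bs i./2); have := odd_double_half (nth 0%N bs j./2).
move: lt bj hi => lt bj hi e1 e2 e3; rewrite e3 in e2.
have lt2 : ((nth 0%N bs i./2).+2 <= nth 0%N bs j./2)%N by lia.
rewrite (leq_ltn_trans (leq_add (leqnn _) (leq_b1 _))) //.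
rewrite (leq_trans _ (leq_addr _ _)) //; lia.
Qed.

(** * The contradiction along an orbit returning near $x_0$ *)

Theorem mainTheorem15 (R : realType) (X : completeNormedModType R[i])
  (T : {linear X -> X}) (lambda : R[i]) :
  separable_space X -> continuous T -> P_BD R T -> `|lambda| = 1 ->
  (T : X -> X) = (fun x => lambda *: x) \/
  ~ quasinilpotent (fun x => T x - lambda *: x).
Proof.
move=> _ Tc TBD lam1.
apply: contrapT => /not_orP[TN /contrapT qn].
have lam0 : lambda != 0 by rewrite -normr_eq0 lam1 oner_eq0.
pose A : {linear X -> X} := T \- lambda \*: idfun.
have Ac : continuous A.
  by move=> x; apply: cvgB; [exact: Tc | apply: cvgZl_tmp; exact: cvg_id].
have decay := quasinilpotent_power_decay A Ac qn.
pose Q : {linear X -> X} := lambda^-1 \*: A.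
have QE x : Q x = lambda^-1 *: A x by [].
have QA n x : rnorm (iter n Q x) = rnorm (iter n A x).
  have -> : iter n Q x = lambda^-1 ^+ n *: iter n A x.
    elim: n => [|n IHn]; first by rewrite scale1r.
    by rewrite iterS IHn QE [A _]linearZ /= scalerA -exprS.
  by rewrite rnormZ rnormX /rnorm normfV lam1 invr1 /= expr1n mul1r.
pose S x := x + Q x.
have TS x : T x = lambda *: S x.
  by rewrite /S /Q /= scalerDr scalerA mulfV // scale1r addrC subrK.
have SZ a x : S (a *: x) = a *: S x by rewrite /S linearZ scalerDr.
have iterT n x : iter n T x = lambda ^+ n *: iter n S x.
  elim: n => [|n IHn]; first by rewrite scale1r.
  by rewrite !iterS IHn TS SZ scalerA -exprS.
have [x0 Qx0] : exists x0, Q x0 != 0.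
  apply: contrapT => /forallNP QN; apply: TN; apply/funext => x.
  by rewrite TS /S; have /negP := QN x; rewrite negbK => /eqP ->; rewrite addr0.
pose d := rnorm (Q x0).
have d0 : 0 < d.
  by rewrite lt_def rnorm_ge0 andbT; apply: contra Qx0 => /eqP/rnorm_eq0 ->.
have Qc : continuous Q by move=> x; apply: cvgZl_tmp; exact: Ac.
have [q q0 Qq] := linear_rnorm_bound Q Qc.
(* The orbit of [S] will be within $2r$ of $x_0$: $r$ from the ball and $r$ from the phases. One
   more application of [S] multiplies this by at most $1+q$, giving $d/8$. *)
pose r := d / (16 * (1 + q)).
have r0 : 0 < r by rewrite divr_gt0 // mulr_gt0 //; lra.
have rd : (1 + q) * (2 * r) = d / 8 by rewrite /r; field; rewrite gt_eqF //; lra.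
pose e1 := r / (rnorm x0 + 1).
have x00 := rnorm_ge0 x0.
have e10 : 0 < e1 by rewrite divr_gt0 //; lra.
have e1r : e1 * rnorm x0 <= r.
  rewrite /e1 mulrAC ler_pdivrMr; last by lra.
  by rewrite ler_pM2l //; lra.
have [C [c cP]] := phase_coloring lambda e1 lam1 e10.
pose U : set X := ball x0 r%:C.
have UP y : U y -> rnorm (y - x0) < r.
  by rewrite /U -ball_normE /= rnormE ltcR rnormC.
have U0 : 0 < r%:C by rewrite ltcR.
have [x xBD] := TBD U (ball_open _ _) (ex_intro _ x0 (ballxx _ U0)).
have [D HD] := pos_density_windows _ xBD.
set B := return_set T x U in HD.
pose DK := (D * #|C|)%N.
(* Since $N\le DK\cdot|bs|$ below, $\rho^m\ge2^{2N}$ once $m\ge|bs|$. *)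
pose rho : R := 2 ^+ (2 * DK).
have rho0 : 0 < rho by exact: exprn_gt0.
have [n0 Hn0] := decay rho rho0.
pose e' := d / 8.
have e'0 : 0 < e' by rewrite divr_gt0.
pose C0 := rnorm x0 + r.
have C00 : 0 < C0 by rewrite /C0; lra.
(* The first summand forces $|bs|\ge n_0$, where the decay holds; the second gives
   $2^N\ge2C_0/e'$. *)
have [N [k [NN HN]]] := HD (n0 * DK + (Num.truncn (2 * C0 / e')).+1)%N.
pose s := [seq i <- iota k N.+1 | i \in B].
have [a Ha] := pigeonhole_count c (c 0%N) s.
pose bs := [seq i <- s | c i == a].
have NL : (N <= DK * size bs)%N.
  rewrite -mulnA (leq_trans HN) // leq_mul2l; apply/orP; right.
  by rewrite -!size_filter in Ha *.
have N0 : (0 < N)%N by apply: leq_trans NN; rewrite addnS.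
have DKL : (0 < DK * size bs)%N by apply: leq_trans NL.
have L0 : (0 < size bs)%N by move: DKL; rewrite muln_gt0 => /andP[].
have DK0 : (0 < DK)%N by move: DKL; rewrite muln_gt0 => /andP[].
have n0L : (n0 <= size bs)%N.
  rewrite -(leq_pmul2l DK0) (leq_trans _ NL) // (leq_trans _ NN) //.
  by rewrite mulnC leq_addr.
have bsP i : i \in bs -> [/\ c i = a, rnorm (iter i T x - x0) < r & (k <= i <= k + N)%N].
  rewrite !mem_filter mem_iota => /andP[/eqP ca /andP[iB ik]]; split=> //.
    by apply: UP; move: iB; rewrite inE.
  by move: ik; rewrite addnS ltnS.
have bsS : sorted ltn bs.
  apply: sorted_filter; first exact: ltn_trans.
  by apply: sorted_filter; [exact: ltn_trans | exact: iota_ltn_sorted].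
have bsO : {in bs &, forall i j, odd i = odd j}.
  by move=> i j /bsP[ci _ _] /bsP[cj _ _]; have [] := cP i j (etrans ci (esym cj)).
have bsK : {in bs, forall i, (k <= i <= k + N)%N} by move=> i /bsP[].
have ptimes := pair_times bs N k L0 bsS bsO bsK.
set b0 := nth 0%N bs 0 in ptimes.
have b0bs : b0 \in bs by exact: mem_nth.
pose y := iter b0 T x.
(* Two nodes for each element of [bs], so $n+1=2|bs|$. *)
pose n := (size bs).*2.-1.
have nE : n.+1 = (size bs).*2 by rewrite /n prednK // double_gt0.
pose t (i : 'I_n.+1) := (nth 0%N bs i./2 - b0 + odd i)%N.
have ilt (i : 'I_n.+1) : (i < (size bs).*2)%N by rewrite -nE.
have orbit_near i : i \in bs -> (b0 <= i)%N -> rnorm (iter (i - b0) S y - x0) <= 2 * r.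
  move=> ibs b0i.
  have rl m : rnorm (lambda ^+ m) = 1 by rewrite rnormX /rnorm lam1 /= expr1n.
  have -> : rnorm (iter (i - b0) S y - x0) =
      rnorm (lambda ^+ i *: (iter (i - b0) S y - x0)) by rewrite rnormZ rl mul1r.
  rewrite scalerBr.
  (* As $T=\lambda S$ and $y=T^{b_0}x$, the two rotations differ only by the phases $\lambda^i$ and
     $\lambda^{b_0}$, which share a colour. *)
  have -> : lambda ^+ i *: iter (i - b0) S y = lambda ^+ b0 *: iter i T x.
    rewrite -{1}(subnKC b0i) exprD -scalerA -iterT /y -iterD subnK //.
  have -> : lambda ^+ b0 *: iter i T x - lambda ^+ i *: x0 =
     lambda ^+ b0 *: (iter i T x - x0) + (lambda ^+ b0 - lambda ^+ i) *: x0.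
    by rewrite scalerBr scalerBl addrA subrK.
  have [ci ri _] := bsP i ibs; have [cb _ _] := bsP b0 b0bs.
  have [_ ph] := cP b0 i (etrans cb (esym ci)).
  apply: (le_trans (rnormD _ _)); rewrite !rnormZ rl mul1r.
  apply: (@le_trans _ _ (r + r)); last by lra.
  apply: lerD; first exact: ltW.
  by apply: le_trans e1r; rewrite ler_wpM2r.
have : d <= 2 * (d / 8 + e').
  apply: (alternating_orbit_bound Q x0 y n N.+1 t).
  - by rewrite -ltnS nE; move: L0; case: (size bs).
  - move=> i j ij; have [_ _ H] := ptimes i (ilt i).
    by apply: H; rewrite ij ilt.
  - by move=> i; have [] := ptimes i (ilt i).
  - move=> i; have [_ b0i _] := ptimes i (ilt i).
    have ibs : nth 0%N bs i./2 \in bs.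
      by apply: mem_nth; rewrite ltn_half_double.
    have h := orbit_near _ ibs b0i; rewrite -/S /t -rd.
    case: (odd i) => /=; last first.
      by rewrite addn0 (le_trans h) // ler_peMl //; [rewrite mulr_ge0 ?ltW | lra].
    rewrite addn1 iterS /S; set u := iter _ _ y in h *.
    rewrite opprD addrACA -linearB /= (le_trans (rnormD _ _)) // mulrDl mul1r.
    apply: lerD => //; apply: (le_trans (Qq _)); by rewrite ler_pM2l.
  - move=> m nm; rewrite QA.
    have Lm : (size bs <= m)%N.
      by apply: leq_trans nm; rewrite -ltnS nE -addnn -[X in (X < _)%N]addn0 ltn_add2l.
    have := Hn0 m (leq_trans n0L Lm) y.
    have yC : rnorm y <= C0.
      have [_ yr _] := bsP b0 b0bs; rewrite -[y](subrK x0) (le_trans (rnormD _ _)) //.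
      by rewrite /C0 addrC lerD2l ltW.
    set z := rnorm (iter m A y); have z0 : 0 <= z by exact: rnorm_ge0.
    move=> /le_trans /(_ yC) hz.
    (* Of the factor $2^{2N}$ in $\rho^m$, one half pays for $2^T$ with $T=N+1$, up to a factor $2$;
       the other makes the remainder at most $e'$. *)
    have big : 2 ^+ N * (2 ^+ N.+1 * z) <= 2 * C0.
      have -> : 2 ^+ N * (2 ^+ N.+1 * z) = 2 * (2 ^+ N * 2 ^+ N * z).
        by rewrite exprS; ring.
      rewrite ler_pM2l //; apply: le_trans hz.
      rewrite ler_wpM2r // -exprD /rho -exprM.
      rewrite ler_eXn2l ?ltr1n // addnn -mul2n -mulnA leq_mul2l /=.
      by rewrite (leq_trans NL) // leq_mul2l Lm orbT.
    have NC : 2 * C0 / e' <= 2 ^+ N.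
      apply: (@le_trans _ _ N%:R); last by rewrite -natrX ler_nat ltnW // ltn_expl.
      apply: (@le_trans _ _ (Num.truncn (2 * C0 / e')).+1%:R).
        by rewrite ltW // truncnS_gt.
      by rewrite ler_nat (leq_trans _ NN) // leq_addl.
    have z2 : 0 <= 2 ^+ N.+1 * z by rewrite mulr_ge0 ?exprn_ge0.
    have := le_trans (ler_wpM2r z2 NC) big.
    rewrite mulrAC ler_pdivrMr // ler_pM2l //; exact: mulr_gt0.
(* The bound now reads $d\le2(d/8+d/8)=d/2$, against $d>0$. *)
rewrite /e'; lra.
Qed.
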